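(* Let $p$ be a prime. In the polynomial ring $\mathbb{Z}[t_1,\dots,t_{p-1}]$, $$\sum_{\sigma\in S_{p-1}}t_{\sigma(1)}\,(t_{\sigma(1)}+t_{\sigma(2)})\cdots(t_{\sigma(1)}+\dots+t_{\sigma(p-1)})\equiv(t_1+\dots+t_{p-1})^{p-1}\pmod p,$$ i.e. all coefficients of the difference of the two sides are divisible by $p$.
   Context: $S_{p-1}$ is the group of permutations of $\{1,\dots,p-1\}$. The summand corresponding to $\sigma$ is $\prod_{k=1}^{p-1}\left(\sum_{i=1}^{k}t_{\sigma(i)}\right)$. *)

(* Defs.v *)
From mathcomp Require Import all_boot all_order all_fingroup all_algebra.
From mathcomp Require Import mpoly.
Set Implicit Arguments.
Unset Strict Implicit.
Unset Printing Implicit Defensive.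
Import GRing.Theory.
Local Open Scope ring_scope.

(* Variables are indexed from 0: 'X_i stands for t_{i+1}, so the 0-based k
   below ranges over 0, ..., n-1 and its factor has the k+1 terms i <= k. *)
Definition perm_summand (n : nat) (s : 'S_n) : {mpoly int[n]} :=
  \prod_(k < n) \sum_(i < n | (i <= k)%N) 'X_(s i).

Definition mpoly_eqmod (n d : nat) (f g : {mpoly int[n]}) : Prop :=
  forall m : 'X_{1..n}, (d%:Z %| (f - g)@_m)%Z.

(* Main.v *)
Require Import Defs.
From HB Require Import structures.
From mathcomp Require Import all_boot all_order all_fingroup all_algebra.
From mathcomp Require Import mpoly.
From mathcomp Require Import ring.
Set Implicit Arguments.
Unset Strict Implicit.
Unset Printing Implicit Defensive.
Import GRing.Theory.
Local Open Scope ring_scope.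

(** Put [n = p - 1] and, over a commutative ring [R] of characteristic [p],
    [H(x) = \sum_s \prod_k (x + t_(s 1) + ... + t_(s k))], so that the left-hand
    side of the congruence is [H(0)].  The point is that [x * H(x)] is additive
    in [x] (lemma [mul_shifted_sum_additive]).  Granting this, let
    [T = t_1 + ... + t_n], assumed nonzero, and let [R] be a domain.  Every
    product in [H(- T)] ends with the factor [T - T], so [H(- T) = 0], and
    additivity makes [H] vanish at all [j T] with [0 < j < p].  Now [H] has
    degree [n] and leading coefficient [n! = -1], and the polynomial
    [- (X^n - T^n)] has the same degree, the same leading coefficient and, by
    Fermat, the same [n] roots; so [H(X) = T^n - X^n] and [H(0) = T^n].

    Additivity is the shadow of a classical fact on derivations: if [D] is a
    derivation of a commutative ring of characteristic [p] and [u] an element of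
    it, then [(u D)^p] is again a derivation, because the inner binomial
    coefficients of the Leibniz formula vanish modulo [p].  Take nilpotent
    variables [X_a] with [X_a^2 = 0] and [D X_a = t_a X_a], and let
    [u = 1 + \sum_a X_a].  Since [u] is invertible, [D (u D)^(p-1)] is a
    derivation too.  Extended by [D g = x g] for a new symbol [g], this operator
    sends [g] to a combination of the products [g X_A], and its coefficient at
    the product of all [n] variables is [x * H(x)]: in each of the [n] steps one
    variable is brought in by [u], and the next [D] multiplies by [x] plus the
    weights of the variables present so far.  Applying it to a product [g h] of
    two such symbols of weights [x] and [y] gives the additivity in [x].

    Below, an element [\sum_A phi(A) X_A] is the function [phi] on finite sets,
    multiplication is [convol], [weigh x] is [D] on the multiples of a symbol of
    weight [x], [adjoin] is the multiplication by [u], and [step x] is [u D].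
    The congruence is the case of polynomials over ['F_p]. *)

(** * Set functions and the Leibniz formula *)

Section SetFunctions.
Variables (R : comNzRingType) (I : finType) (t : I -> R).
Implicit Types (A B : {set I}) (x y : R) (phi psi : {ffun {set I} -> R}).

Definition convol phi psi : {ffun {set I} -> R} :=
  [ffun A : {set I} => \sum_(B : {set I} | B \subset A) phi B * psi (A :\: B)].

Definition delta0 : {ffun {set I} -> R} := [ffun A : {set I} => (A == set0)%:R].

Definition adjoin phi : {ffun {set I} -> R} :=
  [ffun A : {set I} => phi A + \sum_(a in A) phi (A :\ a)].

Definition weigh x phi : {ffun {set I} -> R} :=
  [ffun A : {set I} => (x + \sum_(a in A) t a) * phi A].

Definition step x phi := adjoin (weigh x phi).

Lemma convolC phi psi : convol phi psi = convol psi phi.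
Proof.
apply/ffunP => A; rewrite !ffunE (reindex_onto (setD A) (setD A)) /=; last first.
  by move=> B sBA; rewrite setDDr setDv set0U (setIidPr sBA).
apply: eq_big => [B | B]; rewrite subsetDl setDDr setDv set0U.
  by apply/eqP/idP => [<- | /setIidPr //]; rewrite subsetIl.
by move/eqP->; rewrite mulrC.
Qed.

Lemma convol0 phi : convol delta0 phi = phi.
Proof.
apply/ffunP => A; rewrite ffunE (bigD1 set0) ?sub0set //= big1 => [|B /andP[_ nzB]].
  by rewrite ffunE eqxx mul1r setD0 addr0.
by rewrite ffunE (negPf nzB) mul0r.
Qed.

(** [adjoin] is the multiplication by a fixed element, so it can be moved onto
    either factor of a product. *)
Lemma adjoin_convolr phi psi : adjoin (convol phi psi) = convol phi (adjoin psi).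
Proof.
apply/ffunP => A; rewrite !ffunE.
under [X in _ + X = _]eq_bigr do rewrite ffunE.
under [RHS]eq_bigr do rewrite ffunE mulrDr big_distrr /=.
rewrite big_split /=; congr (_ + _).
rewrite (exchange_big_dep (fun B => B \subset A)) /=; last first.
  by move=> a B _ /subsetD1P[].
apply: eq_bigr => B sBA; apply: eq_big => [a | a /andP[aA /subsetD1P[_ aB]]].
  by rewrite inE subsetD1 sBA /= andbC.
by congr (_ * psi _); rewrite !setDDl setUC.
Qed.

Lemma adjoin_convoll phi psi : adjoin (convol phi psi) = convol (adjoin phi) psi.
Proof. by rewrite convolC adjoin_convolr convolC. Qed.

(** The derivation rule: the weight of a set is the sum of the weights of its
    two parts, and the weights [x] and [y] of the symbols add up. *)
Lemma weigh_convol x y phi psi :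
  weigh (x + y) (convol phi psi) =
    convol (weigh x phi) psi + convol phi (weigh y psi).
Proof.
apply/ffunP => A; rewrite !ffunE big_distrr -big_split /=.
apply: eq_bigr => B sBA; rewrite !ffunE (big_setID B) /= (setIidPr sBA).
by ring.
Qed.

Lemma adjoin_is_zmod_morphism : zmod_morphism adjoin.
Proof.
move=> phi psi; apply/ffunP => A; rewrite !ffunE opprD addrACA; congr (_ + _).
by rewrite -sumrB; apply: eq_bigr => a _; rewrite !ffunE.
Qed.

HB.instance Definition _ :=
  GRing.isZmodMorphism.Build _ _ adjoin adjoin_is_zmod_morphism.

Lemma step_is_zmod_morphism x : zmod_morphism (step x).
Proof.
move=> phi psi; rewrite /step -raddfB; congr adjoin.
by apply/ffunP => A; rewrite !ffunE mulrBr.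
Qed.

HB.instance Definition _ x :=
  GRing.isZmodMorphism.Build _ _ (step x) (step_is_zmod_morphism x).

Lemma step_convol x y phi psi :
  step (x + y) (convol phi psi) =
    convol (step x phi) psi + convol phi (step y psi).
Proof.
by rewrite /step weigh_convol raddfD /= adjoin_convoll adjoin_convolr.
Qed.

(** The Leibniz formula of order [n], by Pascal's rule. *)
Lemma iter_step_convol n x y phi psi :
  iter n (step (x + y)) (convol phi psi) =
    \sum_(k < n.+1)
      convol (iter k (step x) phi) (iter (n - k) (step y) psi) *+ 'C(n, k).
Proof.
elim: n => [|n IHn]; first by rewrite big_ord1 subnn bin0.
rewrite iterS IHn raddf_sum /=.
under eq_bigr => k _ do
  rewrite raddfMn /= step_convol -!iterS mulrnDl -subSn -1?ltnS //.
rewrite big_split /= [RHS]big_ord_recl bin0 subn0.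
under [in RHS]eq_bigr => k _ do rewrite lift0 binS mulrnDr subSS addrC.
rewrite big_split /= addrCA; congr (_ + _).
rewrite big_ord_recl [in RHS]big_ord_recr /= (bin_small (ltnSn n)) mulr0n addr0 bin0.
by congr (_ + _); apply: eq_bigr => k _; rewrite lift0 subSS.
Qed.

(** The element [u = 1 + \sum_a X_a] is invertible, its nonconstant part being
    nilpotent; here this is an induction on the size of the set. *)
Lemma adjoin_inj : injective adjoin.
Proof.
move=> phi psi eqU; apply/ffunP => A.
have [m] := ubnP #|A|; elim: m => // m IHm in A *; rewrite ltnS => leAm.
have /ffunP/(_ A) := eqU; rewrite !ffunE.
rewrite (eq_bigr (fun a => psi (A :\ a))) => [/addIr //|a aA].
by apply: IHm; rewrite (cardsD1 a) aA in leAm.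
Qed.

(** * Additivity in characteristic p *)

Section PrimeChar.
Variables (p : nat) (charRp : p \in [pchar R]).

Lemma ffun_mulrn_pchar (phi : {ffun {set I} -> R}) : phi *+ p = 0.
Proof.
by apply/ffunP => A; rewrite ffunMnE ffunE -mulr_natr (pcharf0 charRp) mulr0.
Qed.

(** The Leibniz formula of order [p], applied to the product of two symbols of
    weights [x] and [y], keeps only its two extreme terms. *)
Lemma iter_step_additive x y :
  iter p (step (x + y)) delta0 = iter p (step x) delta0 + iter p (step y) delta0.
Proof.
have p_pr := pcharf_prime charRp; have p_gt0 := prime_gt0 p_pr.
rewrite -{1}(convol0 delta0) iter_step_convol.
rewrite -(prednK p_gt0) big_ord_recl big_ord_recr big1 /= => [|k _].
  rewrite /bump !add0n add1n prednK // subnn bin0 binn !mulr1n.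
  by rewrite convol0 convolC convol0 add0r addrC.
rewrite /bump add0n add1n prednK //.
have /dvdnP[c ->] : (p %| 'C(p, k.+1))%N.
  by apply: prime_dvd_bin => //=; rewrite -[p in (_ < p)%N](prednK p_gt0) ltnS ltn_ord.
by rewrite mulnC mulrnA ffun_mulrn_pchar mul0rn.
Qed.

(** [D (u D)^n] applied to a symbol of weight [x]: the words are the sequences of
    [n] choices made in the factors [u], each adding one new element or none. *)
Definition weighted_words n x := weigh x (iter n (step x) delta0).

(** [(u D)^p = u (D (u D)^(p-1))], so the factor [u] can be cancelled. *)
Lemma weighted_words_additive x y :
  weighted_words p.-1 (x + y) = weighted_words p.-1 x + weighted_words p.-1 y.
Proof.
have p_gt0 := prime_gt0 (pcharf_prime charRp).
have E z : adjoin (weighted_words p.-1 z) = iter p (step z) delta0.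
  by rewrite -{2}(prednK p_gt0) iterS.
by apply: adjoin_inj; rewrite raddfD /= !E iter_step_additive.
Qed.

End PrimeChar.

Lemma weighted_words_small n x A : (n < #|A|)%N -> weighted_words n x A = 0.
Proof.
rewrite ffunE => nA; suff -> : iter n (step x) delta0 A = 0 by rewrite mulr0.
elim: n A nA => [|n IHn] A nA.
  by rewrite ffunE -cards_eq0 (gtn_eqF nA).
rewrite iterS ffunE ffunE IHn ?(ltnW nA) // mulr0 add0r big1 // => a aA.
by rewrite ffunE IHn ?mulr0 //; rewrite (cardsD1 a) aA in nA.
Qed.

End SetFunctions.

(** * Sums over permutations *)

Lemma sum_lift_perm (V : nmodType) n (i : 'I_n.+1) (F : 'S_n.+1 -> V) :
  \sum_s F s = \sum_j \sum_(s : 'S_n) F (lift_perm i j s).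
Proof.
rewrite pair_bigA /= (reindex (fun js => lift_perm i js.1 js.2)) //=.
apply/onW_bij/inj_card_bij; last by rewrite card_prod !card_Sn card_ord factS.
move=> [j s] [j' s'] /= /permP eq_lift.
have eqj : j = j' by have := eq_lift i; rewrite !lift_perm_id.
congr (_, _) => //; apply/permP => k.
have := eq_lift (lift i k); rewrite !lift_perm_lift eqj.
exact: lift_inj.
Qed.

Definition shifted_sum (R : comNzRingType) n (t : 'I_n -> R) x : R :=
  \sum_(s : 'S_n) \prod_(k < n) (x + \sum_(i < n | (i <= k)%N) t (s i)).

(** All products ending with the same [s ord_max = j] share their last factor,
    the total sum; the other factors involve only the remaining [t i]. *)
Lemma shifted_sum_recr (R : comNzRingType) n (t : 'I_n.+1 -> R) x :
  shifted_sum t x =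
    (x + \sum_i t i) * \sum_j shifted_sum (t \o lift j) x.
Proof.
rewrite /shifted_sum (sum_lift_perm ord_max) !big_distrr /=; apply: eq_bigr => j _.
rewrite big_distrr; apply: eq_bigr => s _ /=.
rewrite big_ord_recr /= mulrC; congr (_ * _).
  congr (_ + _); rewrite [RHS](reindex_inj (@perm_inj _ (lift_perm ord_max j s))) /=.
  by apply: eq_bigl => i; rewrite -ltnS ltn_ord.
apply: eq_bigr => k _; congr (_ + _).
rewrite big_mkcond big_ord_recr /= leqNgt ltn_ord addr0 -big_mkcond /=.
apply: eq_bigr => i _; congr t; rewrite -[RHS](lift_perm_lift ord_max).
congr (lift_perm _ _ _ _); apply: val_inj => /=.
by rewrite /bump leqNgt ltn_ord.
Qed.

(** A word of length [n] producing a set of [n] elements must add a new element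
    at each choice: it is an enumeration of the set, that is a permutation.  The
    injection [f] keeps the statement stable under the removal of an element. *)
Lemma weighted_words_image (R : comNzRingType) (I : finType) (t : I -> R) n
    (f : 'I_n -> I) x : injective f ->
  weighted_words t n x [set f i | i : 'I_n] = x * shifted_sum (t \o f) x.
Proof.
elim: n f => [|n IHn] f inj_f.
  have -> : [set f i | i : 'I_0] = set0.
    by apply/setP => a; rewrite inE; apply/imsetP; case; case.
  rewrite !ffunE big_set0 eqxx /shifted_sum (eq_bigr (fun=> 1)) => [|s _].
    by rewrite sumr_const card_Sn addr0.
  by rewrite big_ord0.
rewrite shifted_sum_recr ffunE iterS ffunE -/(weighted_words t n x).
rewrite weighted_words_small ?card_imset ?card_ord // add0r.
rewrite !big_imset /=; try by move=> ? ? _ _; apply: inj_f.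
rewrite [RHS]mulrCA.
congr (_ * _); rewrite big_distrr; apply: eq_bigr => j _ /=.
rewrite -IHn; last by move=> a b /inj_f/lift_inj.
congr (weighted_words t n x _); apply/setP => a.
apply/setD1P/imsetP => [[naj /imsetP[i _ ai]] | [i _ ->]].
  case: (unliftP j i) ai => [i' -> -> | -> aj]; first by exists i'.
  by rewrite aj eqxx in naj.
by rewrite inj_eq // eq_sym neq_lift imset_f.
Qed.

(** The last factor of every product is [- T + T], where [T] is the total sum. *)
Lemma shifted_sum_opp (R : comNzRingType) n (t : 'I_n -> R) :
  (0 < n)%N -> shifted_sum t (- \sum_i t i) = 0.
Proof. by case: n t => // n t _; rewrite shifted_sum_recr addNr mul0r. Qed.

Section PrimeCharSum.
Variables (R : comNzRingType) (p : nat) (charRp : p \in [pchar R]).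

Lemma mul_shifted_sum_additive (t : 'I_p.-1 -> R) x y :
  (x + y) * shifted_sum t (x + y) = x * shifted_sum t x + y * shifted_sum t y.
Proof.
have E z := @weighted_words_image R _ t _ id z (@inj_id _).
by rewrite -!E (weighted_words_additive t charRp) ffunE.
Qed.

Lemma pchar_predn_fact : (p.-1`!)%:R = -1 :> R.
Proof.
have p_pr := pcharf_prime charRp.
apply/eqP; rewrite -addr_eq0 natr1 -(dvdn_pcharf charRp).
by rewrite -Wilson ?prime_gt1.
Qed.

Lemma pchar_fermat j : (j%:R : R) ^+ p = j%:R.
Proof. exact: (pFrobenius_aut_nat charRp). Qed.

Lemma natr_inj_ltn_pchar i j :
  (i < p)%N -> (j < p)%N -> i%:R = j%:R :> R -> i = j.
Proof.
wlog leij : i j / (i <= j)%N => [IH|].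
  by case/orP: (leq_total i j) => le_ltn *; [apply: IH | apply/esym/IH].
move=> ltip ltjp eq_ij; rewrite -(modn_small ltip) -(modn_small ltjp).
apply/eqP; rewrite eq_sym eqn_mod_dvd // (dvdn_pcharf charRp).
by rewrite natrB // eq_ij subrr.
Qed.

End PrimeCharSum.

(** * Interpolation at the multiples of the total sum *)

Lemma size_prod_XaddC_subXn (R : comNzRingType) n (c : 'I_n -> R) :
  (size (\prod_(k < n) ('X + (c k)%:P) - 'X^n : {poly R})%R <= n)%N.
Proof.
set P := \prod_(k < n) _.
have P_monic : P \is monic by apply: monic_prod => k _; apply: monicXaddC.
have sizeP : size P = n.+1.
  have -> : P = \prod_(k <- enum 'I_n) ('X - (- c k)%:P).
    by rewrite big_enum; apply: eq_bigr => k _; rewrite polyCN opprK.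
  by rewrite size_prod_XsubC -cardE card_ord.
apply/leq_sizeP => i; rewrite leq_eqVlt => /predU1P[<- | lt_ni].
  have /monicP := P_monic; rewrite lead_coefE sizeP /= => coefPn.
  by rewrite coefB coefXn eqxx coefPn subrr.
by rewrite coefB coefXn (gtn_eqF lt_ni) subr0 nth_default // sizeP.
Qed.

Section Domain.
Variables (R : idomainType) (p : nat) (charRp : p \in [pchar R]).
Variable t : 'I_p.-1 -> R.

Let predp_gt0 : (0 < p.-1)%N.
Proof. by rewrite -subn1 subn_gt0 (prime_gt1 (pcharf_prime charRp)). Qed.

(** The additive map [L z = z * shifted_sum t z] kills [- T], hence all integer
    multiples of [T]; at [j T], with [j] prime to [p], the factor [z] is nonzero
    and can be cancelled. *)
Lemma shifted_sum_multiples j :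
  ~~ (p %| j)%N -> \sum_i t i != 0 -> shifted_sum t (j%:R * \sum_i t i) = 0.
Proof.
set s := \sum_i t i => pj s_neq0.
pose L z := z * shifted_sum t z.
have Ls : L s = 0.
  have := mul_shifted_sum_additive charRp t s (- s).
  by rewrite subrr mul0r shifted_sum_opp // mulr0 addr0.
have Ljs : L (j%:R * s) = 0.
  elim: (j) => [|k IHk]; first by rewrite /L !mul0r.
  rewrite -natr1 mulrDl mul1r /L (mul_shifted_sum_additive charRp) -!/(L _).
  by rewrite IHk Ls addr0.
apply/eqP; move/eqP: Ljs; rewrite /L !mulf_eq0 -(dvdn_pcharf charRp).
by rewrite (negPf pj) (negPf s_neq0).
Qed.

(** The congruence over a domain.  For [T] nonzero, [X |-> shifted_sum t X] is
    determined by its leading term and its [p.-1] roots; for [T = 0] both sides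
    vanish. *)
Lemma shifted_sum0 : shifted_sum t 0 = (\sum_i t i) ^+ p.-1.
Proof.
have p_pr := pcharf_prime charRp; have p_gt0 := prime_gt0 p_pr.
have [s0|s_neq0] := eqVneq (\sum_i t i) 0.
  by have := shifted_sum_opp t predp_gt0; rewrite s0 oppr0 expr0n gtn_eqF.
set s := \sum_i t i in s_neq0 *.
pose P (sg : 'S_p.-1) : {poly R} :=
  \prod_(k < p.-1) ('X + (\sum_(i < p.-1 | (i <= k)%N) t (sg i))%:P).
(* G is H + X^n - T^n with n = p.-1: since n! = -1, subtracting X^n from each
   of the n! monic products P amounts to adding X^n to their sum H. *)
pose G := \sum_sg (P sg - 'X^(p.-1)) - (s ^+ p.-1)%:P.
have GE x : G.[x] = shifted_sum t x + x ^+ p.-1 - s ^+ p.-1.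
  rewrite !hornerE horner_sum; congr (_ - _).
  rewrite (eq_bigr (fun sg => (P sg).[x] - x ^+ p.-1)) => [|sg _]; last first.
    by rewrite !hornerE.
  rewrite sumrB sumr_const card_Sn -mulr_natr (pchar_predn_fact charRp) mulrN1 opprK.
  congr (_ + _); apply: eq_bigr => sg _; rewrite horner_prod.
  by apply: eq_bigr => k _; rewrite !hornerE.
have sizeG : (size G <= p.-1)%N.
  rewrite (leq_trans (size_polyD _ _)) // geq_max size_polyN.
  rewrite (leq_trans (size_polyC_leq1 _)) // andbT.
  apply: (leq_trans (size_sum _ _ _)); apply/bigmax_leqP => sg _.
  exact: size_prod_XaddC_subXn.
have G0 : G = 0.
  apply: (@roots_geq_poly_eq0 _ _ [seq j%:R * s | j <- iota 1 p.-1]); last first.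
  - by rewrite size_map size_iota.
  - rewrite map_inj_in_uniq ?iota_uniq // => i j.
    rewrite !mem_iota add1n prednK // => /andP[_ ltip] /andP[_ ltjp].
    move/(mulIf s_neq0).
    exact: (natr_inj_ltn_pchar charRp).
  apply/allP => x /mapP[j].
  rewrite mem_iota add1n prednK // => /andP[j_gt0 ltjp] ->.
  have pj : ~~ (p %| j)%N by rewrite gtnNdvd.
  rewrite rootE GE shifted_sum_multiples // add0r exprMn.
  suff -> : (j%:R : R) ^+ p.-1 = 1 by rewrite mul1r subrr.
  apply: (@mulfI _ (j%:R : R)); first by rewrite -(dvdn_pcharf charRp).
  by rewrite -exprS prednK // (pchar_fermat charRp) mulr1.
have := GE 0; rewrite G0 horner0 expr0n gtn_eqF // addr0 => /esym/eqP.
by rewrite subr_eq0 => /eqP.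
Qed.

End Domain.

Theorem theorem3 (p : nat) (p_prime : prime p) :
  mpoly_eqmod p
    (\sum_(s : 'S_p.-1) perm_summand s)
    ((\sum_(i < p.-1) 'X_i) ^+ p.-1).
Proof.
move=> m; rewrite (dvdz_pcharf (pchar_Fp p_prime)) -mcoeff_map_mpoly rmorphB /=.
rewrite rmorphXn !rmorph_sum /= (eq_bigr _ (fun i _ => map_mpolyX _ _)).
have charRp : p \in [pchar {mpoly 'F_p[p.-1]}].
  by rewrite pchar_lalg pchar_Fp.
rewrite -(shifted_sum0 charRp) /shifted_sum -sumrB big1 ?mcoeff0 // => s _.
apply/eqP; rewrite subr_eq0 rmorph_prod; apply/eqP/eq_bigr => k _.
rewrite add0r rmorph_sum; apply: eq_bigr => i _; exact: map_mpolyX.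
Qed.
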